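(* Let $P$ be a poset of finite length with least element $\hat0$, and let $G$ be a building set of $P$ such that $\operatorname{ub}A\subseteq G$ for every subset $A\subseteq P$ with $|\operatorname{ub}A|\ge 2$. Then the order complex $\Delta(P_{>\hat0})$ is a subdivision of the nested set complex $\mathcal{N}(P,G)$.
   Context: For $X\subseteq P$, $P_{\geq X}=\{a\in P: a\geq x\ \forall x\in X\}$ and $\operatorname{ub}X=\min P_{\ge X}$ is the set of minimal elements of $P_{\ge X}$. The join $\bigvee X$ exists if $P_{\ge X}$ has a least element. For $x\in P$, $F_G(x)=\max\{g\in G: g\le x\}$ (maximal elements). $P_{>\hat0}=P\setminus\{\hat0\}$. A subset $G\subseteq P\setminus\{\hat0\}$ is a building set of $P$ if for every $x\in P$, with $F_G(x)=\{x_1,\dots,x_t\}$, there is a poset isomorphism $\psi_x:\prod_{i=1}^t[\hat0,x_i]\to[\hat0,x]$ with $\psi_x(\hat0,\dots,\hat0,x_i,\hat0,\dots,\hat0)=x_i$ for all $i$. A finite subset $N\subseteq G$ is nested if for every subset $A\subseteq N$ with $|A|\ge2$ of pairwise incomparable elements, $\bigvee A$ exists and $\bigvee A\notin G$; $\mathcal N(P,G)$ is the abstract simplicial complex of nested sets, with vertex set $G$. The order complex $\Delta(Q)$ of a poset $Q$ is the simplicial complex of all finite chains of $Q$. *)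

(* Defs.v *)
From HB Require Import structures.
From mathcomp Require Export all_boot all_order all_algebra finmap.
From mathcomp Require Export boolp classical_sets functions cardinality reals.

Set Implicit Arguments.
Unset Strict Implicit.
Unset Printing Implicit Defensive.

Import Order.TTheory GRing.Theory Num.Theory.
Local Open Scope classical_set_scope.
Local Open Scope ring_scope.

Definition minimals (d : Order.disp_t) (P : porderType d) (A : set P) : set P :=
  [set x | A x /\ forall y, A y -> (y <= x)%O -> y = x].

Definition maximals (d : Order.disp_t) (P : porderType d) (A : set P) : set P :=
  [set x | A x /\ forall y, A y -> (x <= y)%O -> y = x].

(* The paper's P_{>= X} is the library's [ubound X], and j is the join of X
   exactly when [supremums X j]. *)
Definition ub (d : Order.disp_t) (P : porderType d) (X : set P) : set P :=
  minimals (ubound X).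

Definition is_chain (d : Order.disp_t) (P : porderType d) (s : {fset P}) : Prop :=
  {in s &, forall x y, (x >=< y)%O}.

(* The length of a finite chain is one less than its cardinality; the length of
   P is the supremum of the lengths of its chains. *)
Definition finite_length (d : Order.disp_t) (P : porderType d) : Prop :=
  exists n : nat, forall s : {fset P}, is_chain s -> (#|` s| <= n.+1)%N.

(* F_G(x) *)
Definition factors (d : Order.disp_t) (P : porderType d) (G : set P) (x : P) :
    set P :=
  maximals [set g | G g /\ (g <= x)%O].

(* The product of the intervals [\bot, xs i], inside P^t. *)
Definition box (d : Order.disp_t) (P : porderType d) (t : nat) (xs : 'I_t -> P) :
    set ('I_t -> P) :=
  [set u | forall i, (u i <= xs i)%O].

Definition building_set (d : Order.disp_t) (P : bPOrderType d) (G : set P) :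
    Prop :=
  ~ G \bot%O /\
  forall x : P, exists (t : nat) (xs : 'I_t -> P),
    [/\ injective xs,
        range xs = factors G x
      & exists psi : ('I_t -> P) -> P,
          [/\ set_bij (box xs) [set y | (y <= x)%O] psi,
              forall u v, box xs u -> box xs v ->
                (psi u <= psi v)%O <-> (forall i, (u i <= v i)%O)
            & forall i, psi (fun j => if j == i then xs i else \bot%O) = xs i]].

Definition nested (d : Order.disp_t) (P : porderType d) (G : set P)
    (N : {fset P}) : Prop :=
  (forall x, x \in N -> G x) /\
  forall A : {fset P}, (A `<=` N)%fset -> (2 <= #|` A|)%N ->
    (forall x y, x \in A -> y \in A -> x != y -> (x >< y)%O) ->
    exists2 j, supremums [set` A] j & ~ G j.

(* The vertices are the v with [fset v] a face. The empty set may be a face. *)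
Record complex (V : choiceType) := Complex {
  face : set {fset V};
  face_sub : forall s t : {fset V}, (s `<=` t)%fset -> face t -> face s
}.

Definition complex_iso (V W : choiceType) (K : complex V) (L : complex W) : Prop :=
  exists f : V -> W,
    (forall v w, face K [fset v]%fset -> face K [fset w]%fset -> f v = f w -> v = w) /\
    face L = [set [fset f v | v in s]%fset | s in face K].

Lemma chain_sub (d : Order.disp_t) (P : porderType d) (Q : set P)
    (s t : {fset P}) : (s `<=` t)%fset ->
  is_chain t /\ (forall x, x \in t -> Q x) ->
  is_chain s /\ (forall x, x \in s -> Q x).
Proof.
move=> /fsubsetP st [ct Qt]; split; last by move=> x /st /Qt.
by move=> x y /st xt /st yt; exact: ct.
Qed.

(* The order complex of the subposet Q of P. *)
Definition order_complex (d : Order.disp_t) (P : porderType d) (Q : set P) :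
    complex P :=
  Complex (@chain_sub d P Q).

Lemma nested_sub (d : Order.disp_t) (P : porderType d) (G : set P)
    (M N : {fset P}) : (M `<=` N)%fset -> nested G N -> nested G M.
Proof.
move=> MN [NG nN]; split; first by move=> x /(fsubsetP MN) /NG.
by move=> A AM; exact: nN (fsubset_trans AM MN).
Qed.

Definition nested_complex (d : Order.disp_t) (P : porderType d) (G : set P) :
    complex P :=
  Complex (@nested_sub d P G).

Definition affinely_independent (R : realType) (E : lmodType R) (s : {fset E}) :
    Prop :=
  forall c : E -> R,
    \sum_(v <- s) c v = 0 -> \sum_(v <- s) c v *: v = 0 ->
    forall v, v \in s -> c v = 0.

(* The convex hull of the finite set s. *)
Definition simplex (R : realType) (E : lmodType R) (s : {fset E}) : set E :=
  [set p | exists c : E -> R,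
    [/\ forall v, v \in s -> 0 <= c v,
        \sum_(v <- s) c v = 1
      & p = \sum_(v <- s) c v *: v]].

(* A complex on the points of E encodes a family of simplices of E given by
   their vertex sets; it is a geometric simplicial complex when any two of these
   simplices meet in a (possibly empty) common face. *)
Definition geometric (R : realType) (E : lmodType R) (K : complex E) : Prop :=
  (forall s, face K s -> affinely_independent s) /\
  (forall s t, face K s -> face K t ->
    exists u : {fset E},
      [/\ (u `<=` s)%fset, (u `<=` t)%fset & (simplex s `&` simplex t)%classic = simplex u]).

(* Every simplex of K' lies in a simplex of K, and every simplex of K is a finite
   union of simplices of K'. For infinite complexes, finiteness is what makes the
   coherent topologies on the common underlying space agree. *)
Definition geometric_subdivision (R : realType) (E : lmodType R)
    (K' K : complex E) : Prop :=
  (forall s', face K' s' -> exists2 s, face K s & (simplex s' `<=` simplex s)%classic) /\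
  (forall s, face K s ->
    exists L : {fset {fset E}},
      (forall s', s' \in L -> face K' s') /\
      simplex s = \bigcup_(s' in [set` L]) simplex s').

(* D is a subdivision of C: they have geometric realizations K' and K in a common
   real vector space such that K' subdivides K. *)
Definition subdivision (R : realType) (V W : choiceType)
    (D : complex V) (C : complex W) : Prop :=
  exists (E : lmodType R) (K' K : complex E),
    [/\ geometric K', geometric K, complex_iso D K', complex_iso C K
      & geometric_subdivision K' K].

(* Main.v *)
(** Realize the nested set complex on the basis vectors [e_g], [g] in [G], and the
    order complex on the barycenters [v_x] of [e_g], [g] in [F_G(x)]. The condition
    on [ub] makes every [x] the join of its factors. Conversely an antichain of a
    nested set is the set of factors of a unique element, and the factors of the
    elements of a chain form a nested set. A nonnegative combination of a nested set
    is then written greedily as a combination of barycenters of a chain: take the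
    element whose factors are the maximal elements of the support, subtract as much
    of its barycenter as possible, and continue with the smaller support. Reading the
    same steps backwards shows that positive combinations along chains are unique,
    which gives both the geometric simplicial complex and the subdivision. *)
Require Import Defs.
Local Open Scope classical_set_scope.
Local Open Scope card_scope.

Set Implicit Arguments.
Unset Strict Implicit.
Unset Printing Implicit Defensive.

(** * Geometric realizations from unique positive combinations *)

Section Realization.
Import Order.TTheory GRing.Theory Num.Theory.
Local Open Scope ring_scope.
Variables (R : realType) (V : choiceType) (E : lmodType R).
Implicit Types (K : complex V) (f : V -> E) (s t : {fset V}).

Lemma fsubset_imfset f s (u : {fset E}) :
  (u `<=` [fset f v | v in s])%fset ->
  exists2 s', (s' `<=` s)%fset & u = [fset f v | v in s']%fset.
Proof.
move=> us; exists [fset v in s | f v \in u]%fset.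
  by apply/fsubsetP => v; rewrite !inE => /andP[].
apply/fsetP => e; apply/idP/imfsetP => /= [eu|[v]].
  have /imfsetP[v /= vs ev] := fsubsetP us e eu.
  by exists v => //; rewrite !inE vs -ev.
by rewrite !inE => /andP[_ fu] ->.
Qed.

Lemma image_face_sub K f (s t : {fset E}) : (s `<=` t)%fset ->
  [set [fset f v | v in x]%fset | x in face K] t ->
  [set [fset f v | v in x]%fset | x in face K] s.
Proof.
move=> st [t' Kt' tE]; rewrite -tE in st.
have [s' s't' ->] := fsubset_imfset st.
by exists s' => //; exact: face_sub s't' Kt'.
Qed.

Definition image_complex K f : complex E := Complex (@image_face_sub K f).

Lemma simplex_imfset f s : {in s &, injective f} ->
  simplex [fset f v | v in s]%fset =
  [set p | exists a : V -> R,
    [/\ forall v, v \in s -> 0 <= a v, \sum_(v <- s) a v = 1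
      & p = \sum_(v <- s) a v *: f v]].
Proof.
move=> fI; apply/seteqP; split=> p /=.
  move=> [c [c0 c1 ->]]; exists (c \o f); split=> /=.
  - by move=> v vs; apply: c0; exact: in_imfset.
  - by rewrite -c1 big_imfset.
  - by rewrite big_imfset.
move=> [a [a0 a1 ->]].
(* Summing over the fibres of [f] transports [a] to points of [E]; injectivity on [s] leaves a
   single term. *)
pose c e := \sum_(v <- s | f v == e) a v.
have cf v : v \in s -> c (f v) = a v.
  move=> vs; rewrite /c big_mkcond (big_fsetD1 v)//= eqxx big_seq big1 ?addr0//.
  by move=> w; rewrite !inE => /andP[wv ws]; case: eqP => // /fI E0;
    rewrite E0 ?eqxx in wv.
exists c; split.
- by move=> e /imfsetP[v /= vs ->]; rewrite cf// a0.
- by rewrite big_imfset//= -a1; apply: eq_big_seq => v vs; rewrite cf.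
- by rewrite big_imfset//=; apply: eq_big_seq => v vs; rewrite cf.
Qed.

(** The coefficients need not sum to 1: the open cones spanned by the faces are simplicial and
    pairwise disjoint. Both axioms of a geometric simplicial complex are derived from this one
    property. *)
Definition positive_combinations_unique K f := forall s t (a b : V -> R),
  face K s -> face K t ->
  (forall v, v \in s -> 0 < a v) -> (forall v, v \in t -> 0 < b v) ->
  \sum_(v <- s) a v *: f v = \sum_(v <- t) b v *: f v ->
  s = t /\ {in s, a =1 b}.

Lemma big_pos_support (a : V -> R) (f : V -> E) s :
  (forall v, v \in s -> 0 <= a v) ->
  \sum_(v <- [fset v in s | 0 < a v]%fset) a v *: f v = \sum_(v <- s) a v *: f v.
Proof.
move=> a0; apply: big_fset_incl.
  by apply/fsubsetP => v; rewrite !inE => /andP[].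
move=> v vs; rewrite !inE vs /= lt_def (a0 _ vs) andbT negbK => /eqP ->.
by rewrite scale0r.
Qed.

Section Unique.
Variables (K : complex V) (f : V -> E).
Hypothesis fK : positive_combinations_unique K f.

Lemma vertex_injective v w :
  face K [fset v]%fset -> face K [fset w]%fset -> f v = f w -> v = w.
Proof.
move=> Kv Kw fvw.
have [|||/fsetP/(_ v)] := fK (a := fun=> 1) (b := fun=> 1) Kv Kw.
- by move=> *; exact: ltr01.
- by move=> *; exact: ltr01.
- by rewrite !big_seq_fset1 fvw.
by rewrite !inE eqxx => /esym/eqP.
Qed.

Lemma face_injective s : face K s -> {in s &, injective f}.
Proof.
move=> Ks v w vs ws; apply: vertex_injective; apply: face_sub Ks;
  by rewrite fsub1set.
Qed.

Lemma image_complex_iso : complex_iso K (image_complex K f).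
Proof. by exists f; split=> //; exact: vertex_injective. Qed.

(** The positive and negative parts of a vanishing combination give equal positive combinations over
    disjoint faces. Uniqueness makes these faces equal, hence empty. *)
Lemma image_affinely_independent s :
  face K s -> affinely_independent [fset f v | v in s]%fset.
Proof.
move=> Ks c _; rewrite big_imfset /=; last exact: face_injective.
move=> c0 e /imfsetP[v /= vs ->]; set a := c \o f.
pose sp := [fset v in s | 0 < a v]%fset.
pose sm := [fset v in s | 0 < - a v]%fset.
have cE : \sum_(v <- sp) a v *: f v = \sum_(v <- sm) (- a v) *: f v.
  apply/eqP; rewrite -subr_eq0 -sumrN; apply/eqP; rewrite -[RHS]c0.
  rewrite [RHS](big_fsetIDcond _ (fun v => 0 < a v))/=; congr (_ + _).
  transitivity (\sum_(i <- sm) a i *: f i).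
    by apply: eq_bigr => i _; rewrite scaleNr opprK.
  apply: big_fset_incl.
    apply/fsubsetP => i; rewrite !inE oppr_gt0 => /andP[-> /=] /ltW.
    by rewrite leNgt.
  move=> i; rewrite !inE oppr_gt0 => /andP[-> /=].
  rewrite -!leNgt => ai ai'.
  have /eqP : a i == 0 by rewrite eq_le ai ai'.
  by rewrite /a /= => ->; rewrite scale0r.
have sub (p : pred V) : face K [fset v in s | p v]%fset.
  by apply: face_sub Ks; apply/fsubsetP => i; rewrite !inE => /andP[].
have [||spm _] := fK (sub _) (sub _) _ _ cE.
- by move=> i; rewrite !inE => /andP[].
- by move=> i; rewrite !inE => /andP[].
have /fsetP/(_ v) := spm; rewrite !inE vs /= oppr_gt0 -/(a v).
by case: ltgtP.
Qed.

(** A common point has two expressions. Once the zero coefficients are dropped, uniqueness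
    identifies their supports, which then lie in both [s] and [t]. *)
Lemma image_simplexI s t : face K s -> face K t ->
  simplex [fset f v | v in s]%fset `&` simplex [fset f v | v in t]%fset =
  simplex [fset f v | v in (s `&` t)%fset]%fset.
Proof.
move=> Ks Kt; have Kst : face K (s `&` t)%fset by apply: face_sub Ks; exact: fsubsetIl.
rewrite !simplex_imfset; [|exact: face_injective..].
have sub w (p : pred V) : face K w -> face K [fset v in w | p v]%fset.
  by move=> Kw; apply: face_sub Kw; apply/fsubsetP => i; rewrite !inE => /andP[].
apply/seteqP; split=> p /=.
  move=> [[a [a0 a1 pa]] [b [b0 b1 pb]]].
  have := pb; rewrite pa -(big_pos_support f a0) -(big_pos_support f b0).
  move=> /(fK (sub _ _ Ks) (sub _ _ Kt))[||st _].
  - by move=> i; rewrite !inE => /andP[].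
  - by move=> i; rewrite !inE => /andP[].
  have aout v : v \in s -> v \notin (s `&` t)%fset -> a v = 0.
    move=> vs; have /fsetP/(_ v) := st; rewrite !inE vs /=.
    case: (v \in t) => //= /negbT; rewrite lt_def a0// andbT negbK.
    by move=> /eqP.
  exists a; split.
  - by move=> v; rewrite !inE => /andP[/a0].
  - by rewrite -a1; apply: big_fset_incl => //; exact: fsubsetIl.
  - rewrite big_pos_support//; apply/esym/big_fset_incl; first exact: fsubsetIl.
    by move=> v vs vst; rewrite aout// scale0r.
move=> [a [a0 a1 ->]].
(* Conversely, a combination over the common face extends by zero. *)
suff extend w : (s `&` t `<=` w)%fset -> exists b : V -> R,
    [/\ forall v, v \in w -> 0 <= b v, \sum_(v <- w) b v = 1
      & \sum_(v <- (s `&` t)%fset) a v *: f v = \sum_(v <- w) b v *: f v].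
  by split; apply: extend; [exact: fsubsetIl|exact: fsubsetIr].
move=> stw; exists (fun v => if v \in (s `&` t)%fset then a v else 0); split.
- by move=> v _; case: ifP => // /a0.
- rewrite -a1; apply/esym; under eq_big_seq => v vs.
    rewrite (_ : a v = if v \in (s `&` t)%fset then a v else 0); last by rewrite vs.
    over.
  by apply: big_fset_incl => // v _ /negbTE ->.
- under eq_big_seq => v vs.
    rewrite (_ : a v = if v \in (s `&` t)%fset then a v else 0); last by rewrite vs.
    over.
  by apply: big_fset_incl => // v _ /negbTE ->; rewrite scale0r.
Qed.

Lemma image_complex_geometric : geometric (image_complex K f).
Proof.
split=> [_ [s Ks <-]|_ _ [s Ks <-] [t Kt <-]].
  exact: image_affinely_independent.
exists [fset f v | v in (s `&` t)%fset]%fset; split.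
- by apply/fsubsetP => e /imfsetP[v /=]; rewrite !inE => /andP[vs vt] ->;
    exact: in_imfset.
- by apply/fsubsetP => e /imfsetP[v /=]; rewrite !inE => /andP[vs vt] ->;
    exact: in_imfset.
- exact: image_simplexI.
Qed.

End Unique.
End Realization.

(** * Maximal and minimal elements in posets of finite length *)

Section FiniteLength.
Import Order.TTheory.
Local Open Scope order_scope.
Variables (d : Order.disp_t) (P : porderType d).
Implicit Types (A : set P) (x y z : P) (s : {fset P}).

Lemma is_chainU1 s x : is_chain s -> (forall y, y \in s -> y >=< x) ->
  is_chain (x |` s)%fset.
Proof.
move=> cs sx y z; rewrite !inE => /orP[/eqP->|ys] /orP[/eqP->|zs].
- exact: comparablexx.
- by rewrite comparable_sym; exact: sx.
- exact: sx.
- exact: cs.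
Qed.

(** The height of [x] is the largest cardinality of a chain of elements at most [x]; if [x < y],
    adding [y] lengthens such a chain. Being bounded and strictly increasing, it supports induction
    both downwards and upwards. *)
Lemma finite_length_height : finite_length P ->
  exists (n : nat) (h : P -> nat),
    (forall x, (h x <= n)%N) /\ {homo h : x y / x < y >-> (x < y)%N}.
Proof.
move=> [n Pn]; exists n.+1.
pose Q x k := `[< exists s,
  [/\ is_chain s, forall y, y \in s -> y <= x & #|` s| = k] >].
have Q0 x : exists k, Q x k.
  by exists 0%N; apply/asboolP; exists fset0; split; rewrite ?cardfs0// => y.
have Qn x k : Q x k -> (k <= n.+1)%N by move=> /asboolP[s [/Pn cs _ <-]].
exists (fun x => ex_maxn (Q0 x) (@Qn x)); split.
  by move=> x; case: ex_maxnP => k /Qn.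
move=> x y xy; case: ex_maxnP => k /asboolP[s [cs sx sk]] _.
case: ex_maxnP => m _; apply; apply/asboolP; exists (y |` s)%fset; split.
- apply: is_chainU1 => // z /sx zx; apply: le_comparable.
  exact: le_trans zx (ltW xy).
- by move=> z; rewrite !inE => /orP[/eqP->//|/sx zx]; exact: le_trans zx (ltW xy).
- rewrite cardfsU1 sk (_ : y \notin s)//; apply/negP => /sx.
  by rewrite (lt_geF xy).
Qed.

Hypothesis fP : finite_length P.

Lemma maximal_above A x : A x -> exists2 y, maximals A y & x <= y.
Proof.
have [n [h [hn hlt]]] := finite_length_height fP.
(* The distance from the height to its bound drops when passing to a larger element. *)
have [k] := ubnP (n - h x)%N; elim: k x => // k IH x hx Ax.
have [mx|/existsNP[y /not_implyP[Ay /not_implyP[xy yx]]]] :=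
  pselect (forall y, A y -> x <= y -> y = x); first by exists x.
have ltxy : x < y by rewrite lt_def xy andbT; exact/eqP.
have [|//|z mz yz] := IH y; last by exists z => //; exact: le_trans yz.
by rewrite ltnS in hx; apply: (leq_trans _ hx); rewrite ltn_sub2l// (leq_trans (hlt _ _ ltxy)).
Qed.

Lemma minimal_below A x : A x -> exists2 y, minimals A y & y <= x.
Proof.
have [n [h [hn hlt]]] := finite_length_height fP.
have [k] := ubnP (h x); elim: k x => // k IH x hx Ax.
have [mx|/existsNP[y /not_implyP[Ay /not_implyP[yx xy]]]] :=
  pselect (forall y, A y -> y <= x -> y = x); first by exists x.
have ltyx : y < x by rewrite lt_neqAle yx andbT; exact/eqP.
have [|//|z mz zy] := IH y; last by exists z => //; exact: le_trans yx.
by rewrite ltnS in hx; apply: (leq_trans _ hx); exact: hlt.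
Qed.

Lemma chain_max s : is_chain s -> s != fset0 ->
  exists2 x, x \in s & forall y, y \in s -> y <= x.
Proof.
move=> cs /fset0Pn[x xs].
have [y [/= ys my] _] := @maximal_above [set` s] x xs.
exists y => // z zs; have /orP[//|yz] := cs _ _ zs ys.
by rewrite (my z).
Qed.

End FiniteLength.

Lemma card_ge2 (T : Type) (A : set T) (x y : T) :
  A x -> A y -> x <> y -> `I_2 #<= A.
Proof.
move=> Ax Ay xy.
suff [f] : $|{injfun `I_2 >-> A}| by exact: inj_card_le.
apply/injfunPex; exists (fun n => if n == 0%N then x else y).
  by move=> n _; case: ifP.
move=> m n; rewrite !inE /=.
case: m n => [|[|//]] [|[|//]] _ _ //= E0; by case: xy.
Qed.

(** * Building sets: every element is the join of its factors *)

Section Building.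
Import Order.TTheory.
Local Open Scope order_scope.
Variables (d : Order.disp_t) (P : bPOrderType d) (G : set P).
Implicit Types (x y z g : P) (s A N : {fset P}).
Hypotheses (fP : finite_length P) (bG : building_set G).

Lemma factor_below x g : G g -> g <= x -> exists2 h, factors G x h & g <= h.
Proof. by move=> Gg gx; apply: (maximal_above fP). Qed.

Lemma factors_building g : G g -> factors G g = [set g].
Proof.
move=> Gg; apply/seteqP; split=> [h [[Gh hg] mh]|_ ->].
  by rewrite /= (mh g).
by split=> // h [_ hg] gh; apply/le_anti; rewrite hg.
Qed.

Lemma finite_factors x : finite_set (factors G x).
Proof.
have [_ /(_ x)[t [xs [_ <- _]]]] := bG.
by apply: finite_image; exact: finite_finset.
Qed.

(* [y] is the image under [psi] of the tuple whose coordinates are those of the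
   [j g], so that [y] meets every interval [\bot, g] in [\bot, j g]. *)
Lemma factorwise_bound x (j : P -> P) :
  (forall g, factors G x g -> j g <= g) ->
  exists2 y, y <= x &
    forall g z, factors G x g -> z <= g -> (z <= y <-> z <= j g).
Proof.
move=> jle; have [_ /(_ x)[t [xs [_ xsF [psi [[psiX _ psiS] psi_le psi1]]]]]] := bG.
pose e i k := if k == i then xs i else \bot.
have be i : box xs (e i) by move=> k; rewrite /e; case: eqP => [->|_]; rewrite ?le0x.
have Fxs i : factors G x (xs i) by rewrite -xsF; exists i.
(* As [psi] is an order isomorphism sending [e i] to [xs i], everything below [xs i] comes from a
   tuple supported at [i]. *)
have coord i z : z <= xs i -> exists2 w, box xs w /\ psi w = z &
    forall k, k != i -> w k = \bot.
  move=> zi; have [w bw wz] : [set psi w | w in box xs] z.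
    by apply: psiS; apply: le_trans zi _; case: (Fxs i) => -[].
  exists w => // k ki; have /(_ k) : forall k, w k <= e i k.
    by apply/(psi_le w (e i)) => //; rewrite wz psi1.
  by rewrite /e (negbTE ki) lex0 => /eqP.
have /choice[w wP] : forall i, exists w, box xs w /\ psi w = j (xs i).
  by move=> i; have [w wP _] := coord i _ (jle _ (Fxs i)); exists w.
pose u i := w i i.
have bu : box xs u by move=> i; have [bw _] := wP i; exact: bw.
exists (psi u); first exact: psiX.
move=> g z; rewrite -xsF => -[i _ <-] /(coord i)[v [bv <-] vi].
have [bw <-] := wP i.
(* The tuple [v] is supported at [i], where [u] and [w i] agree, so both comparisons are decided
   there. *)
rewrite !psi_le//; split=> le_v k;
  have [->|/vi->] := eqVneq k i; rewrite ?le0x//; exact: le_v.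
Qed.

(** In the product, a tuple above every [xs i] placed at coordinate [i] is the top tuple. *)
Lemma factors_generate x y :
  y <= x -> (forall g, factors G x g -> g <= y) -> y = x.
Proof.
have [_ /(_ x)[t [xs [_ xsF [psi [[psiX _ psiS] psi_le psi1]]]]]] := bG.
move=> yx Fy; apply/le_anti; rewrite yx /=.
have [u bu uy] := psiS _ yx; have [w bw <-] := psiS x (lexx _).
rewrite -uy; apply/psi_le => // i; apply: le_trans (bw i) _.
have : psi (fun k => if k == i then xs i else \bot) <= psi u.
  by rewrite psi1 uy; apply: Fy; rewrite -xsF; exists i.
rewrite psi_le//; first by move=> /(_ i); rewrite eqxx.
by move=> k; case: eqP => [->|_]; rewrite ?le0x.
Qed.

Hypothesis ubG : forall A : set P, `I_2 #<= ub A -> ub A `<=` G.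

(** By [factors_generate], [x] is a minimal upper bound of its factors. A second minimal one, [y],
    would force [x] into [G] by the condition on [ub]; then [x] is its own factor, so [x <= y] after
    all. *)
Lemma factors_sup x : supremums (factors G x) x.
Proof.
have xub : ubound (factors G x) x by move=> g [[]].
split=> // z zub; have [y ymin yz] := minimal_below fP zub.
have xmin : ub (factors G x) x.
  by split=> // u uub ux; apply: factors_generate => // g; exact: uub.
apply: le_trans yz; have [->//|/eqP xy] := eqVneq x y.
have Gx : G x by apply: (ubG _ xmin); exact: card_ge2 xmin ymin xy.
by case: ymin => yub _; apply: yub; rewrite factors_building.
Qed.

Definition ffactors x : {fset P} := fset_set (factors G x).

Lemma in_ffactors x g : g \in ffactors x <-> factors G x g.
Proof. by rewrite in_fset_set ?inE//; exact: finite_factors. Qed.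

Lemma ffactors_le x g : g \in ffactors x -> g <= x.
Proof. by move=> /in_ffactors[[]]. Qed.

Lemma ffactors_building x g : g \in ffactors x -> G g.
Proof. by move=> /in_ffactors[[]]. Qed.

Lemma ffactors1 g : G g -> ffactors g = [fset g]%fset.
Proof.
move=> Gg; apply/fsetP => h; apply/idP/fset1P => [/in_ffactors|->].
  by rewrite factors_building.
by apply/in_ffactors; rewrite factors_building.
Qed.

Lemma ffactors_least x y : (forall g, g \in ffactors x -> g <= y) -> x <= y.
Proof. by move=> Fy; apply: (factors_sup x).2 => g /in_ffactors/Fy. Qed.

Lemma ffactors_inj : injective ffactors.
Proof.
move=> x y Fxy; apply/le_anti/andP; split; apply: ffactors_least => g.
  by rewrite Fxy => /ffactors_le.
by rewrite -Fxy => /ffactors_le.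
Qed.

Lemma ffactors0 : ffactors \bot = fset0.
Proof.
apply/fsetP => g; rewrite inE; apply/negP => gF.
have := ffactors_le gF; rewrite lex0 => /eqP g0.
by have := ffactors_building gF; rewrite g0; case: bG.
Qed.

Lemma ffactors_neq0 x : x <> \bot -> exists g, g \in ffactors x.
Proof.
by move=> x0; apply/fset0Pn/eqP; rewrite -ffactors0 => /ffactors_inj.
Qed.

(** * Nested sets, antichains and factors along chains *)

Definition antichain A := forall x y, x \in A -> y \in A -> x <= y -> x = y.

Lemma antichain_incomparable A :
  antichain A <-> (forall x y, x \in A -> y \in A -> x != y -> x >< y).
Proof.
split=> aA x y xA yA => [|xy].
  move=> xy; apply/negP => /orP[le|le]; move: xy.
    by rewrite (aA x y) ?eqxx.
  by rewrite (aA y x) ?eqxx.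
apply/eqP/negPn/negP => /(aA _ _ xA yA); rewrite /Order.comparable xy.
by [].
Qed.

(** Induction on the chain. Each element of [A] lies below a factor [g] of the top [x]. The part of
    [A] below [g] is the set of factors of some [j g <= g], and [factorwise_bound] glues the [j g]
    into a single element. *)
Lemma chain_antichain_ffactors s A :
  is_chain s -> antichain A ->
  (forall a, a \in A -> exists2 x, x \in s & a \in ffactors x) ->
  exists y, ffactors y = A.
Proof.
have [n] := ubnP #|` s|; elim: n s A => // n IH s A sn cs aA As.
have [s0|s0] := eqVneq s fset0.
  exists \bot; rewrite ffactors0; apply/esym/fsetP => a; rewrite inE.
  by apply/negP => /As[x]; rewrite s0 inE.
have [x xs xmax] := chain_max fP cs s0.
have Ale a : a \in A -> exists2 g, g \in ffactors x & a <= g.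
  move=> /As[z zs aF].
  have [|g /in_ffactors gF ag] := factor_below (x := x) (ffactors_building aF).
    exact: le_trans (ffactors_le aF) (xmax _ zs).
  by exists g.
have AG a : a \in A -> G a by move=> /As[z _ /ffactors_building].
pose Ag g := [fset a in A | a <= g]%fset.
(* If [g] is in [A], it is the only element of [A] below [g]. Otherwise no element of [A] below [g]
   is a factor of [x], by maximality of factors, so the chain without [x] suffices. Off the factors
   of [x], [\bot] is a dummy value. *)
have /choice[j jP] : forall g, exists y, g \in ffactors x -> ffactors y = Ag g.
  move=> g; case: (boolP (g \in ffactors x)) => [gF|_]; last by exists \bot.
  have [gA|gA] := boolP (g \in A).
    exists g => _; rewrite ffactors1; last exact: AG.
    apply/fsetP => a; rewrite !inE; apply/eqP/andP => [->//|[aA' ag]].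
    exact: aA.
  have [|||a|y] := IH (s `\ x)%fset (Ag g).
  - by have := sn; rewrite (cardfsD1 x) xs add1n !ltnS.
  - by move=> y z; rewrite !inE => /andP[_ ys] /andP[_ zs]; exact: cs.
  - by move=> a b; rewrite !inE => /andP[aA' _] /andP[bA _]; exact: aA.
  - rewrite !inE => /andP[aA' ag]; have [z zs aF] := As _ aA'.
    exists z => //; rewrite !inE zs andbT; apply: contraNneq gA => zx.
    rewrite zx in aF; have /in_ffactors[_ /(_ g)->//] := aF.
    by have /in_ffactors[] := gF.
  - by move=> Fy; exists y.
have jle g : g \in ffactors x -> j g <= g.
  move=> gF; apply: ffactors_least => a; rewrite jP// !inE.
  by move=> /andP[].
have [y yx yP] := @factorwise_bound x j (fun g gF => jle g (proj2 (in_ffactors x g) gF)).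
have yub a : a \in A -> a <= y.
  move=> aA'; have [g gF ag] := Ale _ aA'.
  apply/(yP g) => //; first exact/in_ffactors.
  by apply: ffactors_le; rewrite jP// !inE aA'.
(* Hence the maximal elements of [G] below [y] are exactly those of the antichain [A]. *)
have yA h : G h -> h <= y -> exists2 a, a \in A & h <= a.
  move=> Gh hy; have [g gF hg] := factor_below Gh (le_trans hy yx).
  have /(yP g)-/(_ gF hg) hj := hy.
  have [a aF ha] := factor_below Gh hj.
  move: aF => /in_ffactors; rewrite jP; last exact/in_ffactors.
  by rewrite !inE => /andP[aA' _]; exists a.
exists y; apply/fsetP => h; apply/idP/idP => [hF|hA].
  have [a aA' ha] := yA _ (ffactors_building hF) (ffactors_le hF).
  have /in_ffactors[_ /(_ a)<-//] := hF.
  by split; [exact: AG|exact: yub].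
apply/in_ffactors; split; first by split; [exact: AG|exact: yub].
move=> g [Gg gy] hg; have [a aA' ga] := yA _ Gg gy.
have ha := aA _ _ hA aA' (le_trans hg ga).
by apply/le_anti; rewrite hg andbT ha.
Qed.

(** An antichain in [N] is the set of factors of some [y], which is then its join. If [y] were in
    [G], it would have a single factor, against the size of the antichain. *)
Lemma nested_chain_factors s N : is_chain s ->
  (forall g, g \in N -> exists2 x, x \in s & g \in ffactors x) -> nested G N.
Proof.
move=> cs Ns; split=> [g /Ns[x _ /ffactors_building]//|A AN A2].
move=> /antichain_incomparable aA.
have [|y Fy] := chain_antichain_ffactors cs aA.
  by move=> a /(fsubsetP AN)/Ns.
exists y; first split.
- by move=> a; rewrite /= -Fy => /ffactors_le.
- by move=> z zA; apply: ffactors_least => g; rewrite Fy => /zA.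
- by move=> Gy; move: A2; rewrite -Fy ffactors1// cardfs1.
Qed.

(* If some factor [g] of the join [j] of [A] were not in [A], replacing it by the
   join of the elements of [A] below [g] would give a smaller upper bound. *)
Lemma nested_antichain_ffactors A :
  nested G A -> antichain A -> exists y, ffactors y = A.
Proof.
move=> [AG nA] aA.
(* This form of nestedness also covers the sizes 0 and 1: the empty join [\bot] is not in [G], and a
   singleton contains its join. *)
have small B : (B `<=` A)%fset -> exists2 j, supremums [set` B] j & G j -> j \in B.
  move=> BA; have [B2|] := leqP 2 #|` B|.
    have [|j jS jG] := nA B BA B2; last by exists j.
    by apply/antichain_incomparable => x y /(fsubsetP BA) xA /(fsubsetP BA) yA; exact: aA.
  case: (posnP #|` B|) => [/cardfs0_eq-> _|B0 B1].
    exists \bot; first by split=> [x|x _] //; rewrite le0x.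
    by case: bG.
  have /cardfs1P[b ->] : #|` B| == 1%N by rewrite eqn_leq B0 -ltnS B1.
  exists b; last by rewrite inE.
  split=> [x /=|x xub]; first by rewrite inE => /eqP->.
  by apply: xub; rewrite /= inE.
have [j [jub jleast] _] := small A (fsubset_refl _).
have FA g : factors G j g -> g \in A.
  move=> gF; pose B := [fset a in A | a <= g]%fset.
  have BA : (B `<=` A)%fset by apply/fsubsetP => a; rewrite !inE => /andP[].
  have [k [kub kleast] kG] := small B BA.
  have kg : k <= g by apply: kleast => a; rewrite /= !inE => /andP[].
  have [|y _ yP] := @factorwise_bound j (fun h => if h == g then k else h).
    by move=> h _; case: eqP => [->|].
  have jy : j <= y.
    apply: jleast => a /= aA'.
    have [h hF ah] := factor_below (AG _ aA') (jub _ aA').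
    apply/(yP h) => //; case: eqP => // hg; apply: kub.
    by rewrite /= !inE aA' -hg.
  have : g <= y by apply: le_trans jy; case: gF => -[].
  move=> /(yP g g gF (lexx _)); rewrite eqxx => gk.
  have kE : k = g by apply/le_anti; rewrite kg.
  by apply: (fsubsetP BA); rewrite -kE; apply: kG; rewrite kE; case: gF => -[].
(* Each [a] in [A] lies below a factor of [j], itself in [A], so they coincide in the antichain. *)
exists j; apply/fsetP => a; apply/idP/idP => [/in_ffactors/FA//|aA'].
have [h hF ah] := factor_below (AG _ aA') (jub _ aA').
by rewrite (aA a h)//; [exact/in_ffactors|exact: FA].
Qed.

End Building.

(** * The two realizations and the subdivision *)

Section Subdivision.
Import Order.TTheory GRing.Theory Num.Theory.
Local Open Scope ring_scope.
Variables (R : realType) (d : Order.disp_t) (P : bPOrderType d) (G : set P).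
Implicit Types (x y z g : P) (s t N : {fset P}) (a b : P -> R).
Hypotheses (fP : finite_length P) (bG : building_set G).
Hypothesis ubG : forall A : set P, `I_2 #<= ub A -> ub A `<=` G.

Local Notation FF := (ffactors G).
Local Notation E := (P -> R^o).
Local Notation Q := [set x : P | x <> \bot%O].

Lemma combinationE s (a : P -> R) (f : P -> E) g :
  (\sum_(x <- s) a x *: f x) g = \sum_(x <- s) a x * f x g.
Proof. by rewrite fct_sumE. Qed.

Definition basis_vector g : E := fun h => (h == g)%:R.

Definition barycenter x : E :=
  fun g => if g \in FF x then #|` FF x|%:R^-1 else 0.

Lemma basis_combinationE N a h :
  (\sum_(g <- N) a g *: basis_vector g) h = if h \in N then a h else 0.
Proof.
rewrite combinationE; case: ifPn => hN.
  rewrite (big_fsetD1 h)//= /basis_vector eqxx mulr1 big_seq big1 ?addr0//.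
  by move=> g; rewrite !inE eq_sym => /andP[/negbTE-> _]; rewrite mulr0.
rewrite big_seq big1// => g gN; rewrite /basis_vector; case: eqP => [hg|_].
  by rewrite hg gN in hN.
by rewrite mulr0.
Qed.

Lemma basis_unique :
  positive_combinations_unique (nested_complex G) basis_vector.
Proof.
move=> s t a b _ _ a0 b0 ab.
have abE h : (if h \in s then a h else 0) = (if h \in t then b h else 0).
  by rewrite -!basis_combinationE ab.
have st : s = t.
  apply/fsetP => h; have := abE h; case: ifPn => hs; case: ifPn => ht // E0.
    by have := a0 _ hs; rewrite E0 ltxx.
  by have := b0 _ ht; rewrite -E0 ltxx.
by split=> // h hs; have := abE h; rewrite -st hs.
Qed.

(** On basis vectors the coefficients are the coordinates, so membership in a simplex can be tested
    on the point itself. *)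
Lemma basis_simplexE N : nested G N ->
  simplex [fset basis_vector g | g in N]%fset =
  [set p : E | [/\ forall g, 0 <= p g, forall g, g \notin N -> p g = 0
    & \sum_(g <- N) p g = 1]].
Proof.
move=> nN; rewrite (simplex_imfset (face_injective basis_unique _))//.
apply/seteqP; split=> p /=.
  move=> [a [a0 a1 ->]]; split.
  - by move=> g; rewrite basis_combinationE; case: ifP => // /a0.
  - by move=> g /negbTE gN; rewrite basis_combinationE gN.
  - by rewrite -a1; apply: eq_big_seq => g gN; rewrite basis_combinationE gN.
move=> [p0 pN p1]; exists p; split=> //.
apply/funext => h; rewrite (basis_combinationE N p).
by case: ifPn => // /pN.
Qed.

Lemma barycenter_gt0 x g : g \in FF x -> 0 < barycenter x g.
Proof.
move=> gF; rewrite /barycenter gF invr_gt0 ltr0n cardfs_gt0.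
by apply/fset0Pn; exists g.
Qed.

Lemma barycenter_ge0 x g : 0 <= barycenter x g.
Proof. by rewrite /barycenter; case: ifP => // _; rewrite invr_ge0. Qed.

Lemma barycenter_notin x g : g \notin FF x -> barycenter x g = 0.
Proof. by rewrite /barycenter => /negbTE ->. Qed.

Lemma sum_barycenter x N : x <> \bot%O -> (FF x `<=` N)%fset ->
  \sum_(g <- N) barycenter x g = 1.
Proof.
move=> x0 xN; rewrite -(big_fset_incl _ xN); last by move=> g _ /barycenter_notin.
rewrite (eq_big_seq (fun=> #|` FF x|%:R^-1)); last first.
  by move=> g; rewrite /barycenter => ->.
rewrite big_const_seq count_predT iter_addr_0 -[LHS]mulr_natl; apply: (@mulfV R).
by rewrite pnatr_eq0 -lt0n cardfs_gt0; apply/fset0Pn; exact: ffactors_neq0.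
Qed.

Lemma combination_ge s a x g :
  (forall x, x \in s -> 0 < a x) -> x \in s ->
  a x * barycenter x g <= (\sum_(x <- s) a x *: barycenter x) g.
Proof.
move=> a0 xs; rewrite combinationE (big_fsetD1 x)//= lerDl big_seq sumr_ge0//.
by move=> y; rewrite !inE => /andP[_ /a0/ltW ay]; rewrite mulr_ge0// barycenter_ge0.
Qed.

Lemma combination_support s a g :
  (\sum_(x <- s) a x *: barycenter x) g != 0 -> exists2 x, x \in s & g \in FF x.
Proof.
move=> pg; apply: contrapT => nx; case/eqP: pg.
rewrite combinationE big_seq big1// => x xs; rewrite barycenter_notin ?mulr0//.
by apply/negP => gF; apply: nx; exists x.
Qed.

(** Positive terms cannot cancel, so every factor of [x] is in the support of the sum, hence is a
    factor of some element of [t] and lies below [y]. *)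
Lemma combination_le_top s t a b x y :
  (forall x, x \in s -> 0 < a x) ->
  \sum_(x <- s) a x *: barycenter x = \sum_(x <- t) b x *: barycenter x ->
  x \in s -> (forall z, z \in t -> (z <= y)%O) -> (x <= y)%O.
Proof.
move=> a0 ab xs ty; apply: (ffactors_least fP bG ubG) => g gF.
have /lt0r_neq0 : 0 < (\sum_(x <- s) a x *: barycenter x) g.
  apply: lt_le_trans (combination_ge _ a0 xs).
  by rewrite mulr_gt0 ?a0// barycenter_gt0.
rewrite ab => /combination_support[z zt gz].
exact: le_trans (ffactors_le bG gz) (ty _ zt).
Qed.

(* Some factor of the top [x] is a factor of no smaller element of the chain, as
   [x] is the join of its factors; there the combination only sees [a x]. *)
Lemma top_coefficient_le s t a b x :
  is_chain s -> (forall x, x \in s -> x <> \bot%O) ->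
  (forall x, x \in t -> 0 < b x) ->
  \sum_(x <- s) a x *: barycenter x = \sum_(x <- t) b x *: barycenter x ->
  x \in s -> (forall z, z \in s -> (z <= x)%O) -> x \in t -> b x <= a x.
Proof.
move=> cs s0 b0 ab xs xmax xt.
have [g gF gN] : exists2 g, g \in FF x &
    forall z, z \in (s `\ x)%fset -> g \notin FF z.
  apply: contrapT => ng.
  have gz g : g \in FF x -> exists2 z, z \in (s `\ x)%fset & g \in FF z.
    move=> gF; apply: contrapT => nz; apply: ng; exists g => // z zs.
    by apply/negP => gz; apply: nz; exists z.
  have [g0 /gz[z0 z0s _]] := ffactors_neq0 fP bG ubG (s0 _ xs).
  have cs' : is_chain (s `\ x)%fset.
    by move=> y z; rewrite !inE => /andP[_ ys] /andP[_ zs]; exact: cs.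
  have [|y ys ymax] := chain_max fP cs'; first by apply/fset0Pn; exists z0.
  have xy : (x <= y)%O.
    apply: (ffactors_least fP bG ubG) => g /gz[z zs gz'].
    exact: le_trans (ffactors_le bG gz') (ymax _ zs).
  move: ys; rewrite !inE => /andP[yx ys].
  by move: yx; rewrite eq_le xy xmax.
rewrite -(ler_pM2r (barycenter_gt0 gF)); apply: le_trans (combination_ge _ b0 xt) _.
rewrite -ab combinationE (big_fsetD1 x)//= big_seq big1 ?addr0// => z /gN gz.
by rewrite barycenter_notin ?mulr0.
Qed.

(** The tops of the two chains agree by [combination_le_top], and their coefficients by
    [top_coefficient_le], each used in both directions. Cancel this term and induct. *)
Lemma barycenter_unique :
  positive_combinations_unique (order_complex Q) barycenter.
Proof.
move=> s t a b; have [n] := ubnP #|` s|; elim: n s t => // n IH s t sn.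
move=> [/= cs s0] [/= ct t0] a0 b0 ab.
have [s_eq0|s_neq0] := eqVneq s fset0.
  have [->|/fset0Pn[x xt]] := eqVneq t fset0.
    by rewrite s_eq0; split.
  (* [\bot] vacuously bounds the empty chain, so [x] would be [\bot]. *)
  have [] := t0 _ xt; apply/eqP; rewrite -lex0.
  by apply: (combination_le_top b0 (esym ab) xt); rewrite s_eq0.
have [x xs xmax] := chain_max fP cs s_neq0.
have [t_eq0|t_neq0] := eqVneq t fset0.
  have [] := s0 _ xs; apply/eqP; rewrite -lex0.
  by apply: (combination_le_top a0 ab xs); rewrite t_eq0.
have [y yt ymax] := chain_max fP ct t_neq0.
have xy : x = y.
  apply/le_anti; rewrite (combination_le_top a0 ab xs ymax)/=.
  exact: (combination_le_top b0 (esym ab) yt xmax).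
subst y.
have abx : a x = b x.
  apply/le_anti; rewrite (top_coefficient_le cs s0 b0 ab xs xmax yt) andbT.
  exact: (top_coefficient_le ct t0 a0 (esym ab) yt ymax xs).
have sub u : (u `\ x `<=` u)%fset by exact: fsubD1set.
have [||||||st abs] := IH (s `\ x)%fset (t `\ x)%fset.
- by have := sn; rewrite (cardfsD1 x) xs add1n !ltnS.
- exact: chain_sub (sub s) (conj cs s0).
- exact: chain_sub (sub t) (conj ct t0).
- by move=> z /(fsubsetP (sub s))/a0.
- by move=> z /(fsubsetP (sub t))/b0.
- apply: (@addrI _ (a x *: barycenter x)); rewrite {2}abx.
  by move: ab; rewrite (big_fsetD1 x xs) (big_fsetD1 x yt).
split; first by rewrite -(fsetD1K xs) st fsetD1K.
move=> z zs; have [->//|zx] := eqVneq z x; apply: abs.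
by rewrite !inE zx.
Qed.

(* Subtract from [p] the largest multiple of the barycenter of the join of its
   support which keeps it nonnegative, and recurse on the smaller support. *)
Lemma nested_decomposition N (p : E) : nested G N ->
  (forall g, g \in N -> 0 < p g) -> (forall g, g \notin N -> p g = 0) ->
  exists s a,
    [/\ face (order_complex Q) s, forall x, x \in s -> (FF x `<=` N)%fset,
        forall x, x \in s -> 0 < a x & p = \sum_(x <- s) a x *: barycenter x].
Proof.
have [n] := ubnP #|` N|; elim: n N p => // n IH N p Nn nN p0 pN.
have [N0|N_neq0] := eqVneq N fset0.
  exists fset0, (fun=> 0); split=> //; rewrite big_seq_fset0.
  by apply/funext => g; apply: pN; rewrite N0.
pose M := [fset g in N | `[< maximals [set` N] g >]]%fset.
have MN : (M `<=` N)%fset by apply/fsubsetP => g; rewrite !inE => /andP[].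
have Mabove g : g \in N -> exists2 m, m \in M & (g <= m)%O.
  move=> gN; have [m mN gm] := maximal_above (A := [set` N]) fP gN.
  by exists m => //; rewrite !inE; apply/andP; split; [case: mN|exact/asboolP].
have [y yM] : exists y, FF y = M.
  apply: (nested_antichain_ffactors fP bG (nested_sub MN nN)).
  move=> g h; rewrite !inE => /andP[_ /asboolP[_ gmax]] /andP[hN _] gh.
  exact/esym/gmax.
(* The barycenter of [y] is constant on [M], so the smallest coordinate of [p] on [M] bounds the
   multiple that can be subtracted; [g0] then leaves the support. *)
have [g0 g0M g0min] : exists2 g0, g0 \in M & forall g, g \in M -> p g0 <= p g.
  have /fset0Pn[k /Mabove[m mM _]] := N_neq0.
  have [g0 _ g0min] := arg_minP (P := predT) (fun i : M => p (val i))
    (isT : predT [` mM]%fset).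
  exists (val g0); first exact: valP.
  by move=> g gM; exact: (g0min [` gM]%fset).
have y0 : y <> \bot%O.
  by move=> y0; move: g0M; rewrite -yM y0 (ffactors0 bG) inE.
have yN g : g \in N -> (g <= y)%O.
  by move=> /Mabove[m mM gm]; apply: le_trans gm _; apply: (ffactors_le bG); rewrite yM.
pose w := barycenter y g0.
have w0 : 0 < w by apply: barycenter_gt0; rewrite yM.
have yE g : barycenter y g = if g \in M then w else 0.
  by rewrite /w /barycenter yM g0M.
pose c := p g0 / w.
have c0 : 0 < c by rewrite divr_gt0// p0// (fsubsetP MN).
have cyE g : c * barycenter y g = if g \in M then p g0 else 0.
  by rewrite yE; case: ifP => _; rewrite ?mulr0// /c divfK// gt_eqF.
pose q : E := p - c *: barycenter y.
have qE g : q g = p g - c * barycenter y g by [].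
pose N' := [fset g in N | 0 < q g]%fset.
have N'N : (N' `<=` N)%fset by apply/fsubsetP => g; rewrite !inE => /andP[].
have g0N' : g0 \notin N' by rewrite !inE qE cyE g0M subrr ltxx andbF.
have q0 g : 0 <= q g.
  rewrite qE cyE; case: ifPn => gM; first by rewrite subr_ge0 g0min.
  by rewrite subr0; have [/p0/ltW//|/pN->] := boolP (g \in N).
have [|||g|s [a [[cs s0] sN' a0 qs]]] := IH N' q.
- rewrite ltnS in Nn; apply: leq_trans Nn; apply: fproper_ltn_card.
  rewrite fproperEneq N'N andbT; apply: contraNneq g0N' => ->.
  exact: (fsubsetP MN).
- exact: nested_sub N'N nN.
- by move=> g; rewrite !inE => /andP[].
- rewrite !inE negb_and => /orP[gN|].
    rewrite qE cyE pN// (_ : g \in M = false) ?subrr//.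
    by apply: contraNF gN => /(fsubsetP MN).
  by rewrite lt_def q0 andbT negbK => /eqP.
(* [g0] is a factor of [y] outside [N'], whereas the factors of elements of [s] lie in [N']. *)
have ys : y \notin s.
  apply/negP => /sN'/fsubsetP/(_ g0); rewrite yM => /(_ g0M).
  exact/negP.
exists (y |` s)%fset, (fun x => if x == y then c else a x); split.
- split=> [|x]; last by rewrite !inE => /orP[/eqP->//|/s0].
  apply: is_chainU1 => // x xs; apply/le_comparable/(ffactors_least fP bG ubG) => g.
  by move=> /(fsubsetP (sN' _ xs))/(fsubsetP N'N)/yN.
- move=> x; rewrite !inE => /orP[/eqP->|xs]; first by rewrite yM.
  exact: fsubset_trans (sN' _ xs) N'N.
- move=> x; rewrite !inE; case: eqP => // _ /= xs; exact: a0.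
- rewrite big_fsetU1//= eqxx (eq_big_seq (fun x => a x *: barycenter x)).
    by rewrite -qs /q addrC subrK.
  by move=> x xs /=; case: eqP => // xy; rewrite -xy xs in ys.
Qed.

(** The coordinates of each barycenter sum to 1. Thus weights of total 1 on a chain correspond to
    coordinates of total 1 on [N], turning the conical decomposition into a convex one. *)
Lemma sum_combination s a N : (forall x, x \in s -> x <> \bot%O) ->
  (forall x, x \in s -> (FF x `<=` N)%fset) ->
  \sum_(g <- N) (\sum_(x <- s) a x *: barycenter x) g = \sum_(x <- s) a x.
Proof.
move=> s0 sN; under eq_bigr do rewrite combinationE.
rewrite exchange_big /=; apply: eq_big_seq => x xs.
by rewrite -mulr_sumr sum_barycenter ?mulr1//; [exact: s0|exact: sN].
Qed.

Lemma barycenter_simplex_sub s N : face (order_complex Q) s -> nested G N ->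
  (forall x, x \in s -> (FF x `<=` N)%fset) ->
  simplex [fset barycenter x | x in s]%fset `<=`
  simplex [fset basis_vector g | g in N]%fset.
Proof.
move=> Ks nN sN; rewrite (simplex_imfset (face_injective barycenter_unique Ks)).
rewrite basis_simplexE// => p [a [a0 a1 ->]]; split.
- move=> g; rewrite combinationE big_seq sumr_ge0// => x /a0 ax.
  by rewrite mulr_ge0// barycenter_ge0.
- move=> g gN; apply/eqP; apply: contraNT gN => /combination_support[x /sN xN].
  exact: (fsubsetP xN).
- by rewrite sum_combination//; case: Ks.
Qed.

(** Since elements are determined by their factors, these embed into the powerset of [N]. This
    yields the finite union required of a subdivision even when [P] is infinite. *)
Lemma finite_ffactors_sub N : finite_set [set x | (FF x `<=` N)%fset].
Proof.
rewrite (_ : mkset _ = FF @^-1` [set` fpowerset N]); last first.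
  by apply/seteqP; split=> x /=; rewrite fpowersetE.
apply: finite_preimage; last exact: finite_fset.
by move=> x y _ _; exact: (ffactors_inj fP bG ubG).
Qed.

Lemma barycentric_subdivision :
  geometric_subdivision (image_complex (order_complex Q) barycenter)
                        (image_complex (nested_complex G) basis_vector).
Proof.
split=> [_ [s Ks <-]|_ [N nN <-]].
  pose N := (\bigcup_(x <- s) FF x)%fset.
  have nN : nested G N.
    apply: (nested_chain_factors fP bG ubG Ks.1) => g /bigfcupP[x].
    by rewrite andbT => xs gF; exists x.
  exists [fset basis_vector g | g in N]%fset; first by exists N.
  apply: barycenter_simplex_sub => // x xs; apply/fsubsetP => g gF.
  by apply/bigfcupP; exists x; rewrite ?xs.
pose D := fset_set [set x | (FF x `<=` N)%fset].
have inD x : (x \in D) = (FF x `<=` N)%fset.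
  rewrite in_fset_set; last exact: finite_ffactors_sub.
  by apply/idP/idP; rewrite inE.
(* The chains whose barycenters all lie in the simplex of [N]. *)
pose C := [fset s in fpowerset D | `[< face (order_complex Q) s >]]%fset.
have inC s : s \in C <->
    face (order_complex Q) s /\ forall x, x \in s -> (FF x `<=` N)%fset.
  rewrite !inE /= fpowersetE; split=> [/andP[/fsubsetP sD /asboolP Ks]|[Ks sD]].
    by split=> // x /sD; rewrite inD.
  by apply/andP; split; [apply/fsubsetP => x /sD; rewrite inD|exact/asboolP].
pose vertices s := [fset barycenter x | x in s]%fset.
exists (vertices @` C)%fset; split.
  by move=> _ /imfsetP[s /= /inC[Ks _] ->]; exists s.
apply/seteqP; split=> p; last first.
  move=> [_ /= /imfsetP[s /= /inC[Ks sN] ->]].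
  exact: barycenter_simplex_sub.
rewrite basis_simplexE// => -[p0 pN p1].
(* [nested_decomposition] asks for strictly positive coordinates, so [N] is cut down to the support
   of [p]. *)
pose M := [fset g in N | 0 < p g]%fset.
have MN : (M `<=` N)%fset by apply/fsubsetP => g; rewrite !inE => /andP[].
have [||s [a [Ks sM a0 pE]]] := nested_decomposition (p := p) (nested_sub MN nN).
- by move=> g; rewrite !inE => /andP[].
- move=> g; rewrite !inE negb_and => /orP[/pN//|].
  by rewrite lt_def p0 andbT negbK => /eqP.
have sN x : x \in s -> (FF x `<=` N)%fset.
  by move=> /sM xM; exact: fsubset_trans xM MN.
exists [fset barycenter x | x in s]%fset.
  by apply: in_imfset; apply/inC.
rewrite (simplex_imfset (face_injective barycenter_unique Ks)); exists a; split=> //.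
  by move=> x /a0/ltW.
by rewrite -p1 pE sum_combination//; case: Ks.
Qed.

End Subdivision.

Theorem theorem3p4 (R : realType) (d : Order.disp_t) (P : bPOrderType d)
    (G : set P) :
  finite_length P ->
  building_set G ->
  (forall A : set P, `I_2 #<= ub A -> ub A `<=` G) ->
  subdivision R (order_complex [set x : P | x <> \bot%O]) (nested_complex G).
Proof.
move=> fP bG ubG; exists (P -> R^o)%type.
exists (image_complex (order_complex [set x : P | x <> \bot%O]) (barycenter R G)).
exists (image_complex (nested_complex G) (@basis_vector R d P)); split.
- exact: (image_complex_geometric (barycenter_unique fP bG ubG)).
- exact: (image_complex_geometric (basis_unique (G := G))).
- exact: (image_complex_iso (barycenter_unique fP bG ubG)).
- exact: (image_complex_iso (basis_unique (G := G))).
- exact: (barycentric_subdivision R fP bG ubG).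
Qed.
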